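(* Let $k\ge1$ be an integer. There exist constants $\alpha_k,\gamma_k>0$ depending only on $k$ such that the following holds. Let $\lambda\in(0,1)$, let $I$ be a subarc of $\mathbb T$ of length $2\pi\lambda$, let $f\in H^{k,2}$ with $\|f\|_{k,2}\le1$, let $S_n=\{x_1,\dots,x_n\}$ be a set of $n$ distinct points of $I$, and let $f_n$ be the element of minimal $\|\cdot\|_{k,2}$-norm among all $g\in H^{k,2}$ with $g(x_i)=f(x_i)$ for $i=1,\dots,n$. Set $h_n=\sup_{x\in I}d(x,S_n)$. If $h_n\le e^{-\gamma_k/\lambda}$, then $$\|f-f_n\|_2\leq\frac{\alpha_k}{(\lambda\log(1/h_n))^k}.$$
   Context: $\mathbb D$ is the open unit disk, $\mathbb T$ the unit circle. $H^2$ is the Hardy space of $\mathbb D$ with $\|f\|_2=\left(\frac{1}{2\pi}\int_0^{2\pi}|f(e^{i\theta})|^2d\theta\right)^{1/2}$ on boundary values; $H^{k,2}=\{f\in H^2: f^{(j)}\in H^2,\ j=1,\dots,k\}$ with Hilbert norm $\|f\|_{k,2}^2=\sum_{j=0}^k\|f^{(j)}\|_2^2$ (derivatives in $z$). Functions in $H^{k,2}$, $k\ge1$, extend continuously to $\overline{\mathbb D}$, so point values on $\mathbb T$ make sense, and the minimal-norm interpolant $f_n$ exists and is unique (it is the orthogonal projection of $f$ onto the orthogonal complement of the closed subspace of functions vanishing on $S_n$). $d(x,S_n)$ denotes the radial (angular) distance on $\mathbb T$ from $x$ to the set $S_n$. *)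

(* Defs.v *)
From Stdlib Require Import Reals List.
From Coquelicot Require Import Coquelicot.
Open Scope R_scope.

(* An element of H^2 is represented by its Taylor coefficient sequence
   a : nat -> C, f(z) = sum_n a n z^n.  By Parseval,
   ||f||_2^2 = (1/2pi) int |f(e^{it})|^2 dt = sum_n |a n|^2. *)

Fixpoint ffact (n j : nat) : R :=
  match j with
  | O => 1
  | S j' => ffact n j' * (INR n - INR j')
  end.

(* ||f^{(j)}||_2^2 = sum_n (ffact n j)^2 |a n|^2, hence
   ||f||_{k,2}^2 = sum_n (sum_{j=0}^k (ffact n j)^2) |a n|^2 *)
Definition sob_weight (k n : nat) : R := sum_f_R0 (fun j => (ffact n j) ^ 2) k.

Definition sob_terms (k : nat) (a : nat -> C) : nat -> R :=
  fun n => sob_weight k n * (Cmod (a n)) ^ 2.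

(* f in H^{k,2} : f and f^{(1)},...,f^{(k)} are in H^2 *)
Definition in_Hk2 (k : nat) (a : nat -> C) : Prop := ex_series (sob_terms k a).

Definition normk2_sq (k : nat) (a : nat -> C) : R := Series (sob_terms k a).

Definition norm2 (a : nat -> C) : R := sqrt (Series (fun n => (Cmod (a n)) ^ 2)).

Definition Csub (a b : nat -> C) : nat -> C := fun n => Cminus (a n) (b n).

Definition cexp_int (m : nat) (t : R) : C := (cos (INR m * t), sin (INR m * t)).

(* boundary value: f(e^{it}) = v (the Taylor series converges on T for f in H^{k,2}, k>=1) *)
Definition bval (a : nat -> C) (t : R) (v : C) : Prop :=
  is_series (fun m => Cmult (a m) (cexp_int m t)) v.

Definition same_value_at (g f : nat -> C) (t : R) : Prop :=
  exists v : C, bval g t v /\ bval f t v.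

Definition angdist (s t : R) : R :=
  Rmin (Rabs (s - t) - 2 * PI * IZR (Int_part ((Rabs (s - t)) / (2 * PI))))
       (2 * PI - (Rabs (s - t) - 2 * PI * IZR (Int_part ((Rabs (s - t)) / (2 * PI))))).

(* distance from e^{is} to the finite set {e^{it} : t in pts} (pts nonempty) *)
Fixpoint dist_set (s : R) (pts : list R) : R :=
  match pts with
  | nil => 0
  | t :: nil => angdist s t
  | t :: rest => Rmin (angdist s t) (dist_set s rest)
  end.

Definition in_arc (t0 lam t : R) : Prop := t0 <= t <= t0 + 2 * PI * lam.

(* Main.v *)
Require Import Defs.
From Stdlib Require Import Reals List.
From Stdlib Require Import ZArith Lra Lia.
From Coquelicot Require Import Coquelicot.
Open Scope R_scope.

(* The difference g = f - fn has Sobolev norm at most 2 and vanishes on S_n, so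
   by a weighted AM-GM |g| <= 9 on the circle and |g| <= 9 sqrt h on the arc.  A
   two-constants estimate inside the disc of radius 1/4 (multiply g by
   exp (Lam w), where Re w is at most 1 on the arc, at most 0 on the rest of the
   circle, and at least a multiple of lam in the small disc) turns this into
   |a_n| <= 36 4^n exp (- lam log (1/h) / 144) for the Taylor coefficients of g.
   This controls the a_n with n below a multiple of Y = lam log (1/h); for the
   others the Sobolev norm gains the factor n^(-k), that is, Y^(-k). *)

(** * Finite sums, roots of unity and polynomial functions *)

(** The estimates are proved for partial sums of the Taylor series, that is, for polynomials, where
    finite sums over roots of unity do the work of Cauchy's formula and every loss is an absolute
    constant. Truncation destroys exact vanishing at the nodes, but they are finitely many, so a
    long enough partial sum is below any tolerance at all of them. Origin of the constants: [sqrt h]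
    is [exp (- L / 2)] with [L = ln (1 / h)], and the small disc keeps the fraction [1 / (36 q)] of
    that exponent for an arc of length [2 PI / q] with [q <= 2 / lam]; hence [144 = 2 * 36 * 2]. The
    coefficients are split at [n = Y / 576], where [576 = 4 * 144] leaves room for [4 ^ n] squared
    and for a convergent series. Beyond the split, [n / 2] exceeds [Y / 1152], and [gamma = 1152 k]
    makes such [n] at least [2 k], so that falling factorials are comparable with powers. *)

Fixpoint csum (f : nat -> C) (n : nat) : C :=
  match n with O => RtoC 0 | S m => Cplus (csum f m) (f m) end.

Fixpoint rsum (f : nat -> R) (n : nat) : R :=
  match n with O => 0 | S m => rsum f m + f m end.

Lemma csum_ext (f g : nat -> C) (n : nat) :
  (forall i, (i < n)%nat -> f i = g i) -> csum f n = csum g n.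
Proof.
  induction n as [|n IH]; intros H; simpl; [reflexivity|].
  rewrite IH, H; auto with arith.
Qed.

Lemma csum_plus (f g : nat -> C) (n : nat) :
  csum (fun i => Cplus (f i) (g i)) n = Cplus (csum f n) (csum g n).
Proof. induction n as [|n IH]; simpl; [|rewrite IH]; ring. Qed.

Lemma csum_scal (c : C) (f : nat -> C) (n : nat) :
  csum (fun i => Cmult c (f i)) n = Cmult c (csum f n).
Proof. induction n as [|n IH]; simpl; [|rewrite IH]; ring. Qed.

Lemma csum_const (c : C) (n : nat) :
  csum (fun _ => c) n = Cmult (RtoC (INR n)) c.
Proof.
  induction n as [|n IH]; [simpl; ring|].
  rewrite S_INR, RtoC_plus; simpl csum; rewrite IH; ring.
Qed.

Lemma csum_swap (f : nat -> nat -> C) (n m : nat) :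
  csum (fun i => csum (f i) m) n = csum (fun j => csum (fun i => f i j) n) m.
Proof.
  induction n as [|n IH]; simpl.
  - rewrite csum_const; ring.
  - rewrite IH, csum_plus; reflexivity.
Qed.

Lemma csum_succ_l (f : nat -> C) (n : nat) :
  csum f (S n) = Cplus (f O) (csum (fun i => f (S i)) n).
Proof. induction n as [|n IH]; [simpl; ring|]. simpl in *; rewrite IH; ring. Qed.

Lemma csum_single (f : nat -> C) (n j : nat) :
  (j < n)%nat -> (forall i, (i < n)%nat -> i <> j -> f i = RtoC 0) ->
  csum f n = f j.
Proof.
  induction n as [|n IH]; intros Hj H; [lia|]. simpl.
  destruct (Nat.eq_dec j n) as [->|Hne].
  - rewrite (csum_ext f (fun _ => RtoC 0)), csum_const; [ring|].
    intros; apply H; lia.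
  - rewrite IH, (H n); try lia; [ring|]. intros; apply H; lia.
Qed.

Lemma Re_csum (f : nat -> C) (n : nat) : Re (csum f n) = rsum (fun i => Re (f i)) n.
Proof. induction n as [|n IH]; [reflexivity|]. cbn [csum rsum]; rewrite re_plus, IH; reflexivity. Qed.

Lemma Cmod_csum (f : nat -> C) (n : nat) :
  Cmod (csum f n) <= rsum (fun i => Cmod (f i)) n.
Proof.
  induction n as [|n IH]; simpl; [rewrite Cmod_0; lra|].
  eapply Rle_trans; [apply Cmod_triangle|]; lra.
Qed.

Lemma rsum_le (f g : nat -> R) (n : nat) :
  (forall i, (i < n)%nat -> f i <= g i) -> rsum f n <= rsum g n.
Proof.
  induction n as [|n IH]; intros H; simpl; [lra|].
  apply Rplus_le_compat; auto with arith.
Qed.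

Lemma rsum_const (c : R) (n : nat) : rsum (fun _ => c) n = INR n * c.
Proof. induction n as [|n IH]; [simpl; ring|]. rewrite S_INR; simpl rsum; rewrite IH; ring. Qed.

Lemma rsum_scal (c : R) (f : nat -> R) (n : nat) :
  rsum (fun i => c * f i) n = c * rsum f n.
Proof. induction n as [|n IH]; simpl; [|rewrite IH]; ring. Qed.

Lemma rsum_pos (f : nat -> R) (n : nat) :
  (forall i, (i < n)%nat -> 0 <= f i) -> 0 <= rsum f n.
Proof.
  intros H; rewrite <- (Rmult_0_r (INR n)), <- rsum_const; now apply rsum_le.
Qed.

Lemma rsum_add (f : nat -> R) (a b : nat) :
  rsum f (a + b) = rsum f a + rsum (fun i => f (a + i)%nat) b.
Proof.
  induction b as [|b IH]; [rewrite Nat.add_0_r; simpl; ring|].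
  rewrite Nat.add_succ_r; simpl; rewrite IH; ring.
Qed.

Lemma rsum_block_le (f : nat -> R) (a b n : nat) :
  (forall i, 0 <= f i) -> (a + b <= n)%nat ->
  rsum (fun i => f (a + i)%nat) b <= rsum f n.
Proof.
  intros Hf Hn. replace n with (a + b + (n - (a + b)))%nat by lia.
  rewrite !rsum_add.
  pose proof (rsum_pos f a (fun i _ => Hf i)).
  pose proof (rsum_pos (fun i => f (a + b + i)%nat) (n - (a + b)) (fun i _ => Hf _)).
  lra.
Qed.

(** * Points of the circle, roots of unity and coefficient extraction *)

Definition cis (t : R) : C := (cos t, sin t).

Lemma cis_plus (s t : R) : cis (s + t) = Cmult (cis s) (cis t).
Proof. unfold cis, Cmult; simpl; rewrite cos_plus, sin_plus; f_equal; ring. Qed.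

Lemma cis_0 : cis 0 = RtoC 1.
Proof. unfold cis; rewrite cos_0, sin_0; reflexivity. Qed.

Lemma cis_pow (t : R) (n : nat) : Cpow (cis t) n = cis (INR n * t).
Proof.
  induction n as [|n IH]; [simpl; rewrite Rmult_0_l, cis_0; reflexivity|].
  rewrite Cpow_S, IH, <- cis_plus, S_INR; f_equal; ring.
Qed.

Lemma Cmod_cis (t : R) : Cmod (cis t) = 1.
Proof.
  unfold Cmod, cis; simpl. rewrite !Rmult_1_r.
  pose proof (sin2_cos2 t); unfold Rsqr in *.
  replace (_ + _) with 1 by lra. apply sqrt_1.
Qed.

Lemma cis_2PI_nat (n : nat) : cis (2 * PI * INR n) = RtoC 1.
Proof.
  rewrite Rmult_comm, <- cis_pow. unfold cis; rewrite cos_2PI, sin_2PI.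
  apply Cpow_1_l.
Qed.

Lemma Cmod2_1_minus_cis (t : R) : Cmod (Cminus (RtoC 1) (cis t)) ^ 2 = 4 * sin (t / 2) ^ 2.
Proof.
  rewrite Cmod2_alt; unfold cis; simpl.
  replace t with (2 * (t / 2)) at 1 2 3 4 by field.
  rewrite cos_2a, sin_2a. pose proof (sin2_cos2 (t / 2)); unfold Rsqr in *.
  set (c := cos _) in *; set (s := sin _) in *. nra.
Qed.

Definition root (N l : nat) : C := cis (2 * PI * INR l / INR N).

Lemma root_pow_mul (N l d : nat) : Cpow (root N l) d = Cpow (root N d) l.
Proof. unfold root; rewrite !cis_pow; f_equal; unfold Rdiv; ring. Qed.

Lemma root_pow_N (N l : nat) : (0 < N)%nat -> Cpow (root N l) N = RtoC 1.
Proof.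
  intros HN; unfold root; rewrite cis_pow, <- (cis_2PI_nat l); f_equal.
  field; apply not_0_INR; lia.
Qed.

Lemma root_neq_1 (N d : nat) : (0 < d < N)%nat -> root N d <> RtoC 1.
Proof.
  intros Hd E.
  assert (HN : 0 < INR N) by (apply lt_0_INR; lia).
  assert (Hs : 0 < sin (2 * PI * INR d / INR N / 2)).
  { assert (Hd0 : 0 < INR d) by (apply lt_0_INR; lia).
    assert (HdN : INR d < INR N) by (apply lt_INR; lia).
    pose proof PI_RGT_0.
    replace (2 * PI * INR d / INR N / 2) with (PI * (INR d / INR N)) by (field; lra).
    assert (0 < INR d / INR N) by now apply Rdiv_lt_0_compat.
    assert (INR d / INR N < 1) by (apply Rlt_div_l; lra).
    apply sin_gt_0; nra. }
  pose proof (Cmod2_1_minus_cis (2 * PI * INR d / INR N)) as H.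
  fold (root N d) in H; rewrite E in H.
  replace (Cminus (RtoC 1) (RtoC 1)) with (RtoC 0) in H by ring.
  rewrite Cmod_0 in H. nra.
Qed.

Lemma geom_sum (z : C) (n : nat) :
  Cmult (Cminus (RtoC 1) z) (csum (Cpow z) n) = Cminus (RtoC 1) (Cpow z n).
Proof.
  induction n as [|n IH]; [simpl; ring|].
  rewrite Cpow_S; simpl csum; rewrite Cmult_plus_distr_l, IH; ring.
Qed.

(** Exchanging [l] and [d] gives a geometric sum whose ratio [root N d] is not 1 but has [N]-th
    power 1. *)
Lemma root_sum (N d : nat) :
  (0 < d < N)%nat -> csum (fun l => Cpow (root N l) d) N = RtoC 0.
Proof.
  intros Hd.
  rewrite (csum_ext _ (fun l => Cpow (root N d) l)) by (intros; apply root_pow_mul).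
  pose proof (geom_sum (root N d) N) as H.
  rewrite root_pow_N in H by lia.
  destruct (Ceq_dec (csum (fun l => Cpow (root N d) l) N) (RtoC 0)) as [|Hne]; [easy|].
  exfalso; revert H. replace (Cminus (RtoC 1) (RtoC 1)) with (RtoC 0) by ring.
  apply Cmult_neq_0; [|easy].
  intros E; apply (root_neq_1 N d Hd).
  replace (root N d) with (Cminus (RtoC 1) (Cminus (RtoC 1) (root N d))) by ring.
  rewrite E; ring.
Qed.

Definition peval (a : nat -> C) (N : nat) (z : C) : C :=
  csum (fun m => Cmult (a m) (Cpow z m)) N.

(* Discrete Fourier inversion over the N-th roots of unity; the exponent
   N - n stands for -n. *)
Lemma coef_bound (a : nat -> C) (N n : nat) (B : R) :
  (forall t, 0 <= t < 2 * PI -> Cmod (peval a N (cis t)) <= B) ->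
  (n < N)%nat -> Cmod (a n) <= B.
Proof.
  intros HB Hn.
  assert (HN : 0 < INR N) by (apply lt_0_INR; lia).
  assert (E : csum (fun l => Cmult (peval a N (root N l)) (Cpow (root N l) (N - n))) N
    = Cmult (RtoC (INR N)) (a n)).
  { unfold peval.
    rewrite (csum_ext _ (fun l => csum (fun m =>
      Cmult (a m) (Cpow (root N l) (m + (N - n)))) N)).
    2:{ intros l _. rewrite Cmult_comm, <- csum_scal. apply csum_ext; intros m _.
        rewrite Cpow_add_r; ring. }
    rewrite csum_swap, (csum_single _ N n Hn).
    - rewrite csum_scal, (csum_ext _ (fun _ => RtoC 1)), csum_const; [ring|].
      intros l _. replace (n + (N - n))%nat with N by lia. apply root_pow_N; lia.
    - intros m Hm Hmn. rewrite csum_scal.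
      destruct (Nat.lt_ge_cases m n).
      + rewrite root_sum by lia; ring.
      + rewrite (csum_ext _ (fun l => Cpow (root N l) (m - n))).
        * rewrite root_sum by lia; ring.
        * intros l _. replace (m + (N - n))%nat with (N + (m - n))%nat by lia.
          rewrite Cpow_add_r, root_pow_N by lia; ring. }
  apply (f_equal Cmod) in E. rewrite Cmod_mult, Cmod_R, Rabs_pos_eq in E by lra.
  apply (Rmult_le_reg_l (INR N)); [easy|]. rewrite <- E, <- rsum_const.
  eapply Rle_trans; [apply Cmod_csum|]. apply rsum_le; intros l Hl.
  rewrite Cmod_mult, Cmod_pow. unfold root at 2; rewrite Cmod_cis, pow1, Rmult_1_r.
  apply HB. pose proof PI_RGT_0.
  assert (INR l < INR N) by now apply lt_INR.
  pose proof (pos_INR l).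
  assert (0 <= INR l / INR N) by (apply Rle_div_r; lra).
  assert (INR l / INR N < 1) by (apply Rlt_div_l; lra).
  unfold Rdiv in *; nra.
Qed.

(** Coefficients and length stay existential: the functions below are products and high powers whose
    degrees never matter. *)
Definition polyfun (F : C -> C) : Prop :=
  exists (a : nat -> C) (N : nat), forall z, F z = peval a N z.

Lemma peval_pad (a : nat -> C) (N M : nat) (z : C) : (N <= M)%nat ->
  peval (fun m => if (m <? N)%nat then a m else RtoC 0) M z = peval a N z.
Proof.
  unfold peval; induction 1 as [|M HM IH].
  - apply csum_ext; intros i Hi. apply Nat.ltb_lt in Hi; rewrite Hi; reflexivity.
  - simpl; rewrite IH. replace (M <? N)%nat with false; [ring|].
    symmetry; apply Nat.ltb_ge; lia.
Qed.

Lemma polyfun_ext (F G : C -> C) : (forall z, F z = G z) -> polyfun F -> polyfun G.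
Proof. intros E (a & N & H); exists a, N; intros z; rewrite <- E; apply H. Qed.

Lemma polyfun_plus (F G : C -> C) :
  polyfun F -> polyfun G -> polyfun (fun z => Cplus (F z) (G z)).
Proof.
  intros (a & N & Ha) (b & M & Hb).
  exists (fun m => Cplus (if (m <? N)%nat then a m else RtoC 0)
                        (if (m <? M)%nat then b m else RtoC 0)), (N + M)%nat.
  intros z; rewrite Ha, Hb.
  rewrite <- (peval_pad a N (N + M)), <- (peval_pad b M (N + M)) by lia.
  unfold peval; rewrite <- csum_plus; apply csum_ext; intros; ring.
Qed.

Lemma polyfun_scal (c : C) (F : C -> C) : polyfun F -> polyfun (fun z => Cmult c (F z)).
Proof.
  intros (a & N & H); exists (fun m => Cmult c (a m)), N; intros z; rewrite H.
  unfold peval; rewrite <- csum_scal; apply csum_ext; intros; ring.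
Qed.

Lemma polyfun_mul_id (F : C -> C) : polyfun F -> polyfun (fun z => Cmult z (F z)).
Proof.
  intros (a & N & H).
  exists (fun m => match m with O => RtoC 0 | S m' => a m' end), (S N); intros z; rewrite H.
  unfold peval; rewrite csum_succ_l, <- csum_scal, Cmult_0_l, Cplus_0_l.
  apply csum_ext; intros; rewrite Cpow_S; ring.
Qed.

Lemma polyfun_const (c : C) : polyfun (fun _ => c).
Proof. exists (fun _ => c), 1%nat; intros z; unfold peval; simpl; ring. Qed.

Lemma polyfun_csum (F : nat -> C -> C) (n : nat) :
  (forall i, polyfun (F i)) -> polyfun (fun z => csum (fun i => F i z) n).
Proof.
  intros H; induction n as [|n IH]; simpl; [apply polyfun_const|].
  now apply polyfun_plus.
Qed.

Lemma polyfun_mult (F G : C -> C) :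
  polyfun F -> polyfun G -> polyfun (fun z => Cmult (F z) (G z)).
Proof.
  intros (a & N & Ha) HG.
  apply polyfun_ext with (fun z =>
    csum (fun m => Cmult (a m) (Cmult (Cpow z m) (G z))) N).
  - intros z; rewrite Ha; unfold peval. rewrite Cmult_comm, <- csum_scal.
    apply csum_ext; intros; ring.
  - apply polyfun_csum; intros m; apply polyfun_scal.
    induction m as [|m IH].
    + apply polyfun_ext with G; [intros; simpl; ring|easy].
    + apply polyfun_ext with (fun z => Cmult z (Cmult (Cpow z m) (G z))).
      * intros; rewrite Cpow_S; ring.
      * now apply polyfun_mul_id.
Qed.

Lemma polyfun_pow (F : C -> C) (n : nat) : polyfun F -> polyfun (fun z => Cpow (F z) n).
Proof.
  intros H; induction n as [|n IH]; [exact (polyfun_const (RtoC 1))|].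
  now apply (polyfun_mult F (fun z => Cpow (F z) n)).
Qed.

Lemma rsum_geom_le (r : R) (n : nat) : 0 <= r < 1 -> rsum (fun i => r ^ i) n <= / (1 - r).
Proof.
  intros Hr.
  assert (E : (1 - r) * rsum (fun i => r ^ i) n = 1 - r ^ n).
  { induction n as [|n IH]; [simpl; ring|]. simpl rsum.
    rewrite Rmult_plus_distr_l, IH; simpl; ring. }
  pose proof (pow_le r n (proj1 Hr)).
  apply (Rmult_le_reg_l (1 - r)); [lra|]. rewrite E, Rinv_r; lra.
Qed.

(* The loss of 1 / (1 - |z|) against the maximum principle is harmless here, and
   leaves only coefficient bounds to prove. *)
Lemma polyfun_max (F : C -> C) (B : R) (z : C) :
  polyfun F -> (forall t, 0 <= t < 2 * PI -> Cmod (F (cis t)) <= B) ->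
  Cmod z < 1 -> Cmod (F z) <= B * / (1 - Cmod z).
Proof.
  intros (a & N & H) HB Hz.
  assert (Ha : forall n, (n < N)%nat -> Cmod (a n) <= B).
  { intros n; apply coef_bound; intros t Ht; rewrite <- H; auto. }
  assert (HB0 : 0 <= B).
  { eapply Rle_trans; [apply Cmod_ge_0|apply (HB 0)]. pose proof PI_RGT_0; lra. }
  rewrite H. eapply Rle_trans; [apply Cmod_csum|].
  apply Rle_trans with (rsum (fun i => B * Cmod z ^ i) N).
  - apply rsum_le; intros i Hi. rewrite Cmod_mult, Cmod_pow.
    apply Rmult_le_compat_r; [apply pow_le, Cmod_ge_0|auto].
  - rewrite rsum_scal. apply Rmult_le_compat_l; [easy|].
    apply rsum_geom_le; split; [apply Cmod_ge_0|easy].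
Qed.

(** * The two-constants estimate *)

(** The sum over [n <= K] of [1 + 2 z + ... + 2 z^n], an analytic polynomial whose real part on the
    circle is the unnormalised Fejer kernel. *)
Fixpoint fejer (z : C) (K : nat) : C :=
  match K with
  | O => RtoC 1
  | S K' => Cplus (fejer z K')
              (Cminus (Cmult (RtoC 2) (csum (Cpow z) (S K))) (RtoC 1))
  end.

Lemma csum_pow_succ (z : C) (n : nat) :
  csum (Cpow z) (S n) = Cplus (RtoC 1) (Cmult z (csum (Cpow z) n)).
Proof. rewrite csum_succ_l, <- csum_scal; reflexivity. Qed.

(** With [D = 1 + ... + z^K], the next sum is [1 + z D], and [|1 + z D|^2 - |D|^2 = 1 + 2 Re (z D)]
    on the circle, which is the real part of the term added. *)
Lemma Re_fejer_circle (z : C) (K : nat) :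
  Cmod z = 1 -> Re (fejer z K) = Cmod (csum (Cpow z) (S K)) ^ 2.
Proof.
  intros Hz. pose proof (Cmod2_alt z) as H; rewrite Hz in H.
  induction K as [|K IH].
  - simpl csum. replace (Cplus (RtoC 0) (RtoC 1)) with (RtoC 1) by ring.
    rewrite Cmod_1; simpl; ring.
  - cbn [fejer]. rewrite re_plus, IH, (csum_pow_succ z (S K)), !Cmod2_alt.
    set (D := csum (Cpow z) (S K)).
    destruct z as [x y], D as [u v]; simpl in *. nra.
Qed.

(** The factor [1 - z] telescopes the geometric sum to [1 - z^(K+1)], of modulus at most 2. Away
    from its peak the kernel is thus bounded independently of [K]. *)
Lemma Re_fejer_le (z : C) (K : nat) :
  Cmod z = 1 -> Re (fejer z K) * Cmod (Cminus (RtoC 1) z) ^ 2 <= 4.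
Proof.
  intros Hz. rewrite Re_fejer_circle, <- Rpow_mult_distr, <- Cmod_mult by easy.
  rewrite Cmult_comm, (geom_sum z (S K)).
  assert (Cmod (Cminus (RtoC 1) (Cpow z (S K))) <= 2).
  { eapply Rle_trans; [apply Cmod_triangle|].
    rewrite Cmod_opp, Cmod_1, Cmod_pow, Hz, pow1; lra. }
  pose proof (Cmod_ge_0 (Cminus (RtoC 1) (Cpow z (S K)))). nra.
Qed.

(** Each step adds [1 + 2 Re (z D)] with [|z D| <= 1/4 * 4/3 = 1/3], hence at least [1/3]. This is
    where the radius [1/4] comes from. *)
Lemma Re_fejer_ge (z : C) (K : nat) :
  Cmod z <= 1 / 4 -> INR (S K) / 3 <= Re (fejer z K).
Proof.
  intros Hz. pose proof (Cmod_ge_0 z).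
  induction K as [|K IH]; [simpl; lra|].
  cbn [fejer]. rewrite re_plus, (csum_pow_succ z (S K)).
  set (D := csum (Cpow z) (S K)).
  assert (HD : Cmod D <= 4 / 3).
  { eapply Rle_trans; [apply Cmod_csum|].
    eapply Rle_trans.
    - apply rsum_le; intros i _; rewrite Cmod_pow; apply pow_incr; split; [easy|exact Hz].
    - eapply Rle_trans; [apply rsum_geom_le; lra|lra]. }
  assert (Hre : - (1 / 3) <= Re (Cmult z D)).
  { pose proof (re_le_Cmod (Cmult z D)) as H1; rewrite Cmod_mult in H1.
    pose proof (Cmod_ge_0 D).
    assert (Cmod z * Cmod D <= 1 / 4 * (4 / 3)) by now apply Rmult_le_compat.
    apply Rabs_le_between in H1. lra. }
  rewrite S_INR.
  replace (Re (Cminus (Cmult (RtoC 2) (Cplus (RtoC 1) (Cmult z D))) (RtoC 1)))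
    with (1 + 2 * Re (Cmult z D)) by (unfold Re; simpl; ring).
  lra.
Qed.

(** Averaging over the [m]-th roots kills the powers [z^i] with [0 < i < m], so only the constant
    term [K + 1] of the kernel survives. *)
Lemma fejer_sum_root (z : C) (m K : nat) : (K < m)%nat ->
  csum (fun j => fejer (Cmult z (root m j)) K) m = RtoC (INR m * INR (S K)).
Proof.
  intros HK.
  assert (HD : forall n, (0 < n <= m)%nat ->
    csum (fun j => csum (Cpow (Cmult z (root m j))) n) m = RtoC (INR m)).
  { intros n Hn. rewrite csum_swap, (csum_single _ n 0); [| lia |].
    - simpl. rewrite csum_const; ring.
    - intros i Hi Hi0.
      rewrite (csum_ext _ (fun j => Cmult (Cpow z i) (Cpow (root m j) i))).
      + rewrite csum_scal, root_sum by lia; ring.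
      + intros; apply Cpow_mult_l. }
  induction K as [|K IH].
  - cbn [fejer]. rewrite csum_const, RtoC_mult; reflexivity.
  - cbn [fejer]. rewrite csum_plus, IH by lia.
    rewrite (csum_ext _ (fun j => Cplus (Cmult (RtoC 2)
      (csum (Cpow (Cmult z (root m j))) (S (S K)))) (RtoC (Ropp 1)))).
    2:{ intros; rewrite RtoC_opp; unfold Cminus; reflexivity. }
    rewrite csum_plus, csum_scal, HD, csum_const by lia.
    rewrite <- !RtoC_mult, <- !RtoC_plus; f_equal. rewrite (S_INR (S K)); ring.
Qed.

Lemma polyfun_fejer (c : C) (K : nat) : polyfun (fun z => fejer (Cmult z c) K).
Proof.
  assert (Hid : polyfun (fun z => Cmult z c)).
  { apply (polyfun_mul_id (fun _ => c)), polyfun_const. }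
  induction K as [|K IH]; [apply (polyfun_const (RtoC 1))|].
  apply (polyfun_plus _ (fun z => Cminus (Cmult (RtoC 2)
    (csum (Cpow (Cmult z c)) (S (S K)))) (RtoC 1))); [exact IH|].
  apply (polyfun_plus _ (fun _ => Copp (RtoC 1))); [|apply polyfun_const].
  apply polyfun_scal, (polyfun_csum (fun i z => Cpow (Cmult z c) i)).
  intros i; now apply polyfun_pow.
Qed.

Lemma polyfun_bounded (F : C -> C) :
  polyfun F -> exists B, forall t, Cmod (F (cis t)) <= B.
Proof.
  intros (a & N & H). exists (rsum (fun i => Cmod (a i)) N); intros t.
  rewrite H. eapply Rle_trans; [apply Cmod_csum|]. apply rsum_le; intros i _.
  rewrite Cmod_mult, Cmod_pow, Cmod_cis, pow1; lra.
Qed.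

Lemma sin_ge_of_between (a x : R) :
  0 <= a <= PI / 2 -> a <= x <= PI - a -> sin a <= sin x.
Proof.
  intros Ha Hx. destruct (Rle_dec x (PI / 2)).
  - apply sin_incr_1; lra.
  - rewrite <- (sin_PI_x x). apply sin_incr_1; lra.
Qed.

(* An analytic substitute for the harmonic measure of the arc [0, 2 PI / q]:
   Fejer kernels centred at the m-th roots of unity of the middle third of the
   arc, with m large enough for their sum to be small off the arc. *)
Lemma arc_plateau (q : nat) : (1 <= q)%nat ->
  exists w : C -> C, polyfun w /\
    (forall t, Re (w (cis t)) <= 1) /\
    (forall t, 2 * PI / INR q < t < 2 * PI -> Re (w (cis t)) <= 0) /\
    (forall z, Cmod z <= 1 / 4 -> / (18 * INR q) <= Re (w z)).
Proof.
  intros Hq. pose proof PI_RGT_0 as Hpi.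
  assert (Hq1 : 1 <= INR q) by (apply (le_INR 1); lia).
  (* The arc has length [6 * a]; a point off it is at angle at least [2 * a] from the middle third,
     so half that angle is at least [a]. *)
  set (a := PI / (3 * INR q)).
  assert (Ha : 0 < a <= PI / 2).
  { unfold a; split; [apply Rdiv_lt_0_compat; lra|].
    apply Rle_div_l; [lra|]. nra. }
  assert (Hs : 0 < sin a) by (apply sin_gt_0; lra).
  (* Off the arc each kernel is at most [1 / sin a ^ 2], which this choice makes at most [L / 6]. *)
  destruct (INR_unbounded (6 / sin a ^ 2)) as [L0 HL0].
  set (L := S L0).
  assert (HL : 6 <= INR L * sin a ^ 2).
  { unfold L; rewrite S_INR. apply Rlt_div_l in HL0; nra. }
  set (m := (3 * q * L)%nat).
  assert (Hm : INR m = 3 * INR q * INR L).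
  { unfold m; rewrite !mult_INR; simpl; ring. }
  assert (HLm : (3 * L <= m)%nat) by (unfold m; nia).
  assert (HLp : 0 < INR L) by (apply lt_0_INR; unfold L; lia).
  assert (Hmp : 0 < INR m) by (rewrite Hm; nra).
  (* [A z j] peaks at the angle [- 2 PI j / m]. The indices [m - 2 L + i] with [i < L] give the
     angles [2 PI (2 L - i) / m], between [2 * a] and [4 * a] because [m = 3 q L]. *)
  set (A := fun (z : C) (j : nat) => fejer (Cmult z (root m j)) (m - 1)).
  set (S := fun z => csum (fun i => A z (m - 2 * L + i)%nat) L).
  (* The scaled sum is at least [1 / (9 q)] in the small disc and at most [1 / (54 q^2)] off the
     arc; subtracting [1 / (18 q)] keeps half of the former and makes the latter nonpositive. *)
  exists (fun z => Cplus (Cmult (RtoC (/ INR m ^ 2)) (S z)) (RtoC (- / (18 * INR q)))).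
  assert (HRe : forall z,
    Re (Cplus (Cmult (RtoC (/ INR m ^ 2)) (S z)) (RtoC (- / (18 * INR q))))
    = / INR m ^ 2 * rsum (fun i => Re (A z (m - 2 * L + i)%nat)) L - / (18 * INR q)).
  { intros z. unfold S; rewrite <- Re_csum. unfold Re; simpl; ring. }
  assert (Hm2 : 0 < / INR m ^ 2) by (apply Rinv_0_lt_compat, pow_lt; easy).
  assert (Hq18 : 0 < / (18 * INR q)) by (apply Rinv_0_lt_compat; lra).
  assert (Hroot : forall t j, Cmod (Cmult (cis t) (root m j)) = 1).
  { intros; unfold root; rewrite <- cis_plus; apply Cmod_cis. }
  assert (Hmu : / INR m ^ 2 * (INR L * (INR m / 3)) = 2 * / (18 * INR q)).
  { rewrite Hm; field; lra. }
  split; [|split; [|split]].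
  - apply polyfun_plus; [|apply polyfun_const].
    apply polyfun_scal, polyfun_csum; intros; apply polyfun_fejer.
  - intros t; rewrite HRe.
    assert (rsum (fun i => Re (A (cis t) (m - 2 * L + i)%nat)) L <= INR m ^ 2).
    { eapply Rle_trans.
      (* Nonnegativity on the circle lets the block be completed to all [m] kernels, whose sum is
         the constant [m ^ 2]. *)
      - apply (rsum_block_le (fun j => Re (A (cis t) j)) (m - 2 * L) L m); [|lia].
        intros i; unfold A; rewrite Re_fejer_circle by auto. apply pow2_ge_0.
      - rewrite <- Re_csum. unfold A; rewrite fejer_sum_root by lia.
        replace (Datatypes.S (m - 1)) with m by lia. unfold Re; simpl; lra. }
    apply (Rmult_le_compat_l (/ INR m ^ 2)) in H; [|lra].
    rewrite Rinv_l in H by (apply pow_nonzero; lra). lra.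
  - intros t Ht; rewrite HRe.
    assert (Hterm : forall i, (i < L)%nat ->
      Re (A (cis t) (m - 2 * L + i)%nat) <= INR L / 6).
    { intros i Hi. unfold A.
      set (j := (m - 2 * L + i)%nat).
      (* Half the angle from the peak to [cis t]. The full turn in [j = m - (2 L - i)] adds [PI] to
         it, which squaring the sine removes. *)
      set (x := t / 2 - PI * (2 * INR L - INR i) / INR m).
      assert (Hj : INR j = INR m - (2 * INR L - INR i)).
      { unfold j; rewrite plus_INR, minus_INR, mult_INR by lia; simpl; ring. }
      assert (Hx : a <= x <= PI - a).
      { assert (Hi' : 0 <= INR i <= INR L) by (split; [apply pos_INR|apply le_INR; lia]).
        assert (E1 : PI * (2 * INR L - INR i) / INR m = a * ((2 * INR L - INR i) / INR L)).
        { rewrite Hm; unfold a; field; lra. }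
        assert (E2 : 1 <= (2 * INR L - INR i) / INR L <= 2).
        { split; [apply Rle_div_r|apply Rle_div_l]; lra. }
        assert (E3 : 2 * PI / INR q = 6 * a) by (unfold a; field; lra).
        unfold x; rewrite E1. nra. }
      pose proof (sin_ge_of_between a x ltac:(lra) Hx) as Hsx.
      pose proof (Re_fejer_le _ (m - 1) (Hroot t j)) as H.
      assert (E : Cmod (Cminus (RtoC 1) (Cmult (cis t) (root m j))) ^ 2 = 4 * sin x ^ 2).
      { unfold root; rewrite <- cis_plus, Cmod2_1_minus_cis; f_equal.
        replace ((t + 2 * PI * INR j / INR m) / 2) with (x + PI)
          by (unfold x; rewrite Hj; field; lra).
        rewrite neg_sin; ring. }
      rewrite E in H.
      set (R0 := Re _) in *.
      assert (sin a ^ 2 <= sin x ^ 2) by (apply pow_incr; lra).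
      destruct (Rle_dec R0 0); [lra|].
      assert (R0 * sin a ^ 2 <= 1) by nra.
      assert (0 < sin a ^ 2) by now apply pow_lt.
      nra. }
    apply Rle_trans with (/ INR m ^ 2 * (INR L * (INR L / 6)) - / (18 * INR q)).
    + apply Rplus_le_compat_r, Rmult_le_compat_l; [lra|].
      rewrite <- rsum_const; now apply rsum_le.
    + assert (INR L * (INR L / 6) <= INR L * (INR m / 3) / 2).
      { rewrite Hm. nra. }
      nra.
  - intros z Hz; rewrite HRe.
    assert (INR L * (INR m / 3) <= rsum (fun i => Re (A z (m - 2 * L + i)%nat)) L).
    { rewrite <- rsum_const. apply rsum_le; intros i _. unfold A.
      replace (INR m) with (INR (Datatypes.S (m - 1))) by (f_equal; lia).
      apply Re_fejer_ge. unfold root; rewrite Cmod_mult, Cmod_cis; lra. }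
    apply (Rmult_le_compat_l (/ INR m ^ 2)) in H; lra.
Qed.

(** * From the plateau function to Taylor coefficients *)

Lemma exp_le (x y : R) : x <= y -> exp x <= exp y.
Proof. intros [H | ->]; [left; now apply exp_increasing|apply Rle_refl]. Qed.

Lemma exp_INR_mult (n : nat) (x : R) : exp (INR n * x) = exp x ^ n.
Proof.
  induction n as [|n IH]; [rewrite Rmult_0_l; apply exp_0|].
  rewrite S_INR, Rmult_plus_distr_r, exp_plus, IH, Rmult_1_l; simpl; ring.
Qed.

(** The square of the left side is [1 + (2 Re W + |W|^2)], to which [1 + x <= exp x] applies. For
    [W] of order [1 / K] the quadratic error stays bounded in the [K]-th power. *)
Lemma Cmod_1_plus_le (W : C) :
  Cmod (Cplus (RtoC 1) W) <= exp (Re W + Cmod W ^ 2 / 2).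
Proof.
  apply Rsqr_incr_0_var; [|left; apply exp_pos].
  unfold Rsqr; rewrite <- exp_plus.
  apply Rle_trans with (1 + (2 * Re W + Cmod W ^ 2)).
  - apply Req_le. transitivity (Cmod (Cplus (RtoC 1) W) ^ 2); [ring|].
    rewrite !Cmod2_alt; destruct W; simpl; ring.
  - replace (_ + _ + (_ + _)) with (2 * Re W + Cmod W ^ 2) by field.
    apply exp_ineq1_le.
Qed.

Lemma exp_le_1_plus_double (y : R) : 0 <= y <= 1 / 2 -> exp y <= 1 + 2 * y.
Proof.
  intros Hy. pose proof (exp_ineq1_le (- y)) as H. rewrite exp_Ropp in H.
  pose proof (exp_pos y) as Hp.
  assert (exp y * (1 - y) <= 1).
  { apply (Rmult_le_compat_l (exp y)) in H; [|lra]. rewrite Rinv_r in H; lra. }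
  nra.
Qed.

(* With w as in [arc_plateau], the polynomial P (1 + Lam w / K) ^ K stands for
   P exp (Lam w), whose modulus is at most M on the whole circle. *)
Lemma two_constants (a : nat -> C) (N q n : nat) (M Lam : R) :
  (1 <= q)%nat -> 0 <= M -> 0 <= Lam ->
  (forall t, 0 <= t < 2 * PI -> Cmod (peval a N (cis t)) <= M) ->
  (forall t, 0 <= t <= 2 * PI / INR q -> Cmod (peval a N (cis t)) <= M * exp (- Lam)) ->
  (n < N)%nat ->
  Cmod (a n) <= 4 ^ n * (4 * M * exp (- (Lam / (36 * INR q)))).
Proof.
  intros Hq HM HLam HT HI Hn.
  assert (Hq1 : 1 <= INR q) by (apply (le_INR 1); lia).
  destruct (arc_plateau q Hq) as (w & Hw & Hw1 & Hw0 & Hwz).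
  destruct (polyfun_bounded w Hw) as [B HB].
  (* The first term keeps the quadratic error in the exponent below 1, at the cost of a factor
     [exp 1 <= 3]; the second gives [y <= 1 / 2] below. *)
  destruct (INR_unbounded (Lam ^ 2 * B ^ 2 + Lam)) as [K HK].
  assert (HLB : 0 <= Lam ^ 2 * B ^ 2) by (apply Rmult_le_pos; apply pow2_ge_0).
  assert (HKp : 0 < INR K) by lra.
  set (W := fun z => Cmult (RtoC (Lam / INR K)) (w z)).
  set (F := fun z => Cmult (peval a N z) (Cpow (Cplus (RtoC 1) (W z)) K)).
  assert (HReW : forall z, Re (W z) = Lam / INR K * Re (w z)).
  { intros z; unfold W, Re; simpl; ring. }
  assert (HF : polyfun F).
  { apply polyfun_mult; [now exists a, N|].
    apply polyfun_pow, polyfun_plus; [apply polyfun_const|now apply polyfun_scal]. }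
  assert (Hexp : forall t, Cmod (Cpow (Cplus (RtoC 1) (W (cis t))) K)
                           <= 3 * exp (Lam * Re (w (cis t)))).
  { intros t. rewrite Cmod_pow.
    apply Rle_trans with (exp (Re (W (cis t)) + Cmod (W (cis t)) ^ 2 / 2) ^ K).
    { apply pow_incr; split; [apply Cmod_ge_0|apply Cmod_1_plus_le]. }
    rewrite <- exp_INR_mult.
    apply Rle_trans with (exp (1 + Lam * Re (w (cis t)))).
    2:{ rewrite exp_plus. apply Rmult_le_compat_r; [left; apply exp_pos|apply exp_le_3]. }
    apply exp_le. rewrite HReW.
    unfold W; rewrite Cmod_mult, Cmod_R, Rabs_pos_eq by (apply Rle_div_r; lra).
    assert (Cmod (w (cis t)) ^ 2 <= B ^ 2) by (apply pow_incr; split; [apply Cmod_ge_0|easy]).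
    set (c := Cmod _) in *.
    replace (INR K * (Lam / INR K * Re (w (cis t)) + (Lam / INR K * c) ^ 2 / 2))
      with (Lam * Re (w (cis t)) + Lam ^ 2 * c ^ 2 / INR K / 2) by (field; lra).
    assert (Lam ^ 2 * c ^ 2 / INR K <= 1).
    { apply Rle_div_l; [lra|]. pose proof (pow2_ge_0 Lam). nra. }
    lra. }
  assert (HFT : forall t, 0 <= t < 2 * PI -> Cmod (F (cis t)) <= 3 * M).
  { intros t Ht. unfold F; rewrite Cmod_mult.
    specialize (Hexp t). specialize (HT t Ht).
    destruct (Rle_dec t (2 * PI / INR q)) as [Hin|Hout].
    - specialize (HI t (conj (proj1 Ht) Hin)).
      assert (Hle : exp (Lam * Re (w (cis t))) <= exp Lam).
      { apply exp_le. specialize (Hw1 t). nra. }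
      apply Rle_trans with (M * exp (- Lam) * (3 * exp Lam)).
      + apply Rmult_le_compat; try apply Cmod_ge_0; lra.
      + rewrite exp_Ropp. pose proof (exp_pos Lam). apply Req_le; field; lra.
    - assert (Hle : exp (Lam * Re (w (cis t))) <= 1).
      { rewrite <- exp_0; apply exp_le. specialize (Hw0 t ltac:(lra)). nra. }
      rewrite (Rmult_comm 3).
      apply Rmult_le_compat; try apply Cmod_ge_0; lra. }
  set (E := exp (Lam / (36 * INR q))).
  assert (HE : 0 < E) by apply exp_pos.
  assert (HP : forall z, Cmod z = 1 / 4 -> Cmod (peval a N z) * E <= 4 * M).
  { intros z Hz.
    pose proof (polyfun_max F (3 * M) z HF HFT ltac:(lra)) as H.
    rewrite Hz in H. unfold F in H; rewrite Cmod_mult, Cmod_pow in H.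
    assert (HEK : E <= Cmod (Cplus (RtoC 1) (W z)) ^ K).
    (* Half the exponent is given up, 18 becoming 36, so that [exp y <= 1 + 2 * y] bounds [1 + Re W]
       below by an exponential. *)
    { set (y := Lam / (36 * INR q * INR K)).
      replace E with (exp y ^ K).
      2:{ rewrite <- exp_INR_mult; unfold E, y; f_equal; field; lra. }
      apply pow_incr; split; [left; apply exp_pos|].
      assert (Hy : 0 <= y <= 1 / 2).
      { unfold y; split; [apply Rle_div_r; nra|]. apply Rle_div_l; nra. }
      apply Rle_trans with (1 + 2 * y); [now apply exp_le_1_plus_double|].
      apply Rle_trans with (Re (Cplus (RtoC 1) (W z))).
      2:{ eapply Rle_trans; [apply Rle_abs|apply re_le_Cmod]. }
      rewrite re_plus, HReW. specialize (Hwz z ltac:(lra)).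
      replace (2 * y) with (Lam / INR K * / (18 * INR q)) by (unfold y; field; lra).
      apply Rplus_le_compat; [simpl; lra|].
      apply Rmult_le_compat_l; [apply Rle_div_r; lra|easy]. }
    apply Rle_trans with (3 * M * / (1 - 1 / 4)); [|lra].
    eapply Rle_trans; [|exact H]. apply Rmult_le_compat_l; [apply Cmod_ge_0|easy]. }
  (* Extraction on the circle of radius [1/4], through the rescaled coefficients; this produces the
     factor [4 ^ n]. *)
  assert (Hc : Cmod (Cmult (a n) (Cpow (RtoC (1 / 4)) n)) <= 4 * M / E).
  { apply (coef_bound (fun i => Cmult (a i) (Cpow (RtoC (1 / 4)) i)) N); [|easy].
    intros t _. apply Rle_div_r; [easy|].
    replace (peval _ N (cis t)) with (peval a N (Cmult (RtoC (1 / 4)) (cis t))).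
    - apply HP. rewrite Cmod_mult, Cmod_cis, Cmod_R, Rabs_pos_eq; lra.
    - unfold peval; apply csum_ext; intros; rewrite Cpow_mult_l; ring. }
  rewrite Cmod_mult, Cmod_pow, Cmod_R, Rabs_pos_eq in Hc by lra.
  rewrite exp_Ropp; fold E; unfold Rdiv in Hc.
  assert (H4 : 0 < 4 ^ n) by (apply pow_lt; lra).
  replace (Cmod (a n)) with (4 ^ n * (Cmod (a n) * (1 * / 4) ^ n)).
  - apply Rmult_le_compat_l; lra.
  - rewrite Rmult_1_l, pow_inv. field; lra.
Qed.

(** * Vanishing on the nodes and Sobolev weights *)

(* Termwise AM-GM, where u_i / i <= 3 / (i + D) has a telescoping square. *)
Lemma weighted_sum_le (x u : nat -> R) (N : nat) (d D : R) :
  0 < d -> 0 < D ->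
  (forall i, 0 <= u i) -> (forall i, u (S i) * (INR (S i) + D) <= 3 * INR (S i)) ->
  rsum (fun i => x i * u i) (S N) <=
    x O * u O + (d * rsum (fun i => INR i ^ 2 * x i ^ 2) (S N) + 9 / (d * D)) / 2.
Proof.
  intros Hd HD Hu Huw.
  (* The induction needs the telescoped remainder [1 / D - 1 / (N + D)] in full; its last term is
     dropped only afterwards. *)
  enough (H : rsum (fun i => x i * u i) (S N) <=
    x O * u O + (d * rsum (fun i => INR i ^ 2 * x i ^ 2) (S N)
                 + 9 / d * (/ D - / (INR N + D))) / 2).
  { assert (0 < / (INR N + D)) by (apply Rinv_0_lt_compat; pose proof (pos_INR N); lra).
    assert (0 < 9 / d) by (apply Rdiv_lt_0_compat; lra).
    replace (9 / (d * D)) with (9 / d * / D) by (field; lra). nra. }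
  induction N as [|N IH].
  - simpl. rewrite Rplus_0_l. apply Req_le; field; lra.
  - cbn [rsum] in *.
    specialize (Hu (S N)); specialize (Huw N).
    pose proof (pos_INR N) as HN. rewrite S_INR in *.
    set (n := INR N) in *. set (y := x (S N)). set (v := u (S N)) in *.
    assert (Hv : v / (n + 1) <= 3 / (n + 1 + D)).
    { apply Rle_div_l; [lra|].
      replace (3 / (n + 1 + D) * (n + 1)) with (3 * (n + 1) / (n + 1 + D)) by (field; lra).
      apply Rle_div_r; lra. }
    assert (Hv0 : 0 <= v / (n + 1)) by (apply Rle_div_r; lra).
    assert (Hv2 : (v / (n + 1)) ^ 2 <= 9 * (/ (n + D) - / (n + 1 + D))).
    { apply Rle_trans with ((3 / (n + 1 + D)) ^ 2); [now apply pow_incr|].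
      replace (9 * (/ (n + D) - / (n + 1 + D))) with (9 / ((n + 1 + D) * (n + D)))
        by (field; lra).
      replace ((3 / (n + 1 + D)) ^ 2) with (9 / ((n + 1 + D) * (n + 1 + D))) by (field; lra).
      apply Rmult_le_compat_l; [lra|]. apply Rinv_le_contravar; nra. }
    set (r := v / (n + 1)) in *.
    assert (Hyv : y * v <= (d * ((n + 1) ^ 2 * y ^ 2) + r ^ 2 / d) / 2).
    { replace v with (r * (n + 1)) by (unfold r; field; lra).
      assert (0 <= (d * (n + 1) * y - r) ^ 2 / d)
        by (apply Rle_div_r; [lra|rewrite Rmult_0_l; apply pow2_ge_0]).
      replace ((d * (n + 1) * y - r) ^ 2 / d)
        with (d * ((n + 1) ^ 2 * y ^ 2) + r ^ 2 / d - 2 * (y * (r * (n + 1)))) in H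
        by (field; lra).
      lra. }
    assert (Hr : r ^ 2 / d <= 9 / d * (/ (n + D) - / (n + 1 + D))).
    { apply Rle_div_l; [lra|].
      replace (9 / d * (/ (n + D) - / (n + 1 + D)) * d)
        with (9 * (/ (n + D) - / (n + 1 + D))) by (field; lra). easy. }
    lra.
Qed.

Lemma Cmod_pow_sub_le (z w : C) (m : nat) : Cmod z = 1 -> Cmod w = 1 ->
  Cmod (Cminus (Cpow z m) (Cpow w m)) <= INR m * Cmod (Cminus z w).
Proof.
  intros Hz Hw. induction m as [|m IH].
  - simpl. replace (Cminus (RtoC 1) (RtoC 1)) with (RtoC 0) by ring. rewrite Cmod_0; lra.
  - rewrite !Cpow_S, S_INR.
    replace (Cminus (Cmult z (Cpow z m)) (Cmult w (Cpow w m))) with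
      (Cplus (Cmult z (Cminus (Cpow z m) (Cpow w m))) (Cmult (Cminus z w) (Cpow w m))) by ring.
    eapply Rle_trans; [apply Cmod_triangle|].
    rewrite !Cmod_mult, Cmod_pow, Hz, Hw, pow1. lra.
Qed.

Lemma Cmod_cis_sub_2 (s t : R) : Cmod (Cminus (cis s) (cis t)) <= 2.
Proof.
  eapply Rle_trans; [apply Cmod_triangle|]. rewrite Cmod_opp, !Cmod_cis; lra.
Qed.

(** Weights [u = 1] and [d = D = 1] give [2 + (4 + 9) / 2 <= 9]. *)
Lemma peval_cis_bound (a : nat -> C) (N : nat) (t : R) :
  Cmod (a O) <= 2 -> rsum (fun i => INR i ^ 2 * Cmod (a i) ^ 2) (S N) <= 4 ->
  Cmod (peval a (S N) (cis t)) <= 9.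
Proof.
  intros H0 HE.
  eapply Rle_trans; [apply Cmod_csum|].
  apply Rle_trans with (rsum (fun i => Cmod (a i) * 1) (S N)).
  { apply rsum_le; intros i _; rewrite Cmod_mult, Cmod_pow, Cmod_cis, pow1; lra. }
  pose proof (weighted_sum_le (fun i => Cmod (a i)) (fun _ => 1) N 1 1) as H.
  cbv beta in H. eapply Rle_trans; [apply H; try lra|].
  - intros; lra.
  - intros i; rewrite S_INR; pose proof (pos_INR i); lra.
  - lra.
Qed.

(** Here [u i] is at most both 2 and [i * h], so [u i * (i + 1 / h) <= 3 * i]. Taking [D = 1 / h],
    the choice [d = sqrt h] makes both parts of the bound multiples of [sqrt h]: [(4 + 9) / 2]. *)
Lemma peval_cis_diff (a : nat -> C) (N : nat) (s t h : R) :
  0 < h -> Cmod (Cminus (cis s) (cis t)) <= h ->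
  rsum (fun i => INR i ^ 2 * Cmod (a i) ^ 2) (S N) <= 4 ->
  Cmod (Cminus (peval a (S N) (cis s)) (peval a (S N) (cis t))) <= 13 / 2 * sqrt h.
Proof.
  intros Hh Hst HE.
  set (u := fun i => Cmod (Cminus (Cpow (cis s) i) (Cpow (cis t) i))).
  assert (Hs : 0 < sqrt h) by now apply sqrt_lt_R0.
  assert (Hss : sqrt h * sqrt h = h) by (apply sqrt_sqrt; lra).
  pose proof (weighted_sum_le (fun i => Cmod (a i)) u N (sqrt h) (/ h) Hs
    (Rinv_0_lt_compat _ Hh) (fun i => Cmod_ge_0 _)) as H.
  apply Rle_trans with (rsum (fun i => Cmod (a i) * u i) (S N)).
  - replace (Cminus (peval a (S N) (cis s)) (peval a (S N) (cis t))) with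
      (csum (fun i => Cmult (a i) (Cminus (Cpow (cis s) i) (Cpow (cis t) i))) (S N)).
    + eapply Rle_trans; [apply Cmod_csum|].
      apply rsum_le; intros; rewrite Cmod_mult; apply Rle_refl.
    + unfold peval.
      rewrite (csum_ext _ (fun i => Cplus (Cmult (a i) (Cpow (cis s) i))
        (Cmult (RtoC (- (1))) (Cmult (a i) (Cpow (cis t) i))))).
      * rewrite csum_plus, csum_scal, RtoC_opp; ring.
      * intros; rewrite RtoC_opp; ring.
  - eapply Rle_trans; [apply H|].
    + intros i. unfold u.
      pose proof (Cmod_pow_sub_le (cis s) (cis t) (S i) (Cmod_cis s) (Cmod_cis t)) as H1.
      assert (H2 : Cmod (Cminus (Cpow (cis s) (S i)) (Cpow (cis t) (S i))) <= 2)
        by (rewrite !cis_pow; apply Cmod_cis_sub_2).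
      assert (Hn : 1 <= INR (S i)) by (rewrite S_INR; pose proof (pos_INR i); lra).
      set (n := INR (S i)) in *.
      set (c := Cmod (Cminus (Cpow (cis s) (S i)) _)) in *.
      assert (c * / h <= n).
      { apply Rle_div_l; [easy|]. eapply Rle_trans; [exact H1|].
        apply Rmult_le_compat_l; lra. }
      nra.
    + unfold u at 1; simpl Cpow.
      replace (Cminus (RtoC 1) (RtoC 1)) with (RtoC 0) by ring. rewrite Cmod_0.
      replace (9 / (sqrt h * / h)) with (9 * sqrt h).
      2:{ transitivity (9 * (sqrt h * sqrt h) / sqrt h); [field; lra|].
          rewrite Hss; field; lra. }
      nra.
Qed.

Lemma peval_series_zero (g : nat -> C) (t eps : R) :
  bval g t (RtoC 0) -> 0 < eps ->
  exists N0, forall N, (N0 <= N)%nat -> Cmod (peval g (S N) (cis t)) <= eps.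
Proof.
  intros H He.
  assert (HL : locally (RtoC 0 : C_NormedModule) (fun z => Cmod z <= eps)).
  { apply (locally_le_locally_norm (K := C_AbsRing) (V := C_NormedModule)).
    exists (mkposreal eps He); intros y Hy.
    unfold ball_norm in Hy; simpl in Hy.
    replace (minus y (RtoC 0 : C_NormedModule)) with (y : C) in Hy.
    - left; exact Hy.
    - unfold minus, plus, opp; simpl. change ((y : C) = Cplus y (Copp (RtoC 0)) :> C). ring. }
  destruct (H _ HL) as [N0 HN0]. exists N0; intros N HN.
  replace (peval g (S N) (cis t)) with
    (sum_n (fun m => Cmult (g m) (cexp_int m t) : C_NormedModule) N); [now apply HN0|].
  clear. unfold peval.
  assert (E : forall m, cexp_int m t = Cpow (cis t) m) by (intros; symmetry; apply cis_pow).
  induction N as [|N IH].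
  - rewrite sum_O. simpl. rewrite E; simpl. ring.
  - rewrite sum_Sn, IH, E. reflexivity.
Qed.

(** Finiteness of the node set yields one truncation index valid at every node. *)
Lemma peval_series_zero_list (g : nat -> C) (pts : list R) (eps : R) :
  (forall t, In t pts -> bval g t (RtoC 0)) -> 0 < eps ->
  exists N0, forall N, (N0 <= N)%nat ->
    forall t, In t pts -> Cmod (peval g (S N) (cis t)) <= eps.
Proof.
  intros H He; induction pts as [|t pts IH].
  - exists O; intros N _ t [].
  - destruct IH as [N1 H1]; [intros; apply H; now right|].
    destruct (peval_series_zero g t eps) as [N2 H2]; [apply H; now left|easy|].
    exists (N1 + N2)%nat; intros N HN t' [<-|Ht].
    + apply H2; lia.
    + apply H1; [lia|easy].
Qed.

(** * Angular distance and positivity of the fill distance *)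

Lemma angdist_bounds (s t : R) :
  0 <= Rabs (s - t) - 2 * PI * IZR (Int_part (Rabs (s - t) / (2 * PI))) < 2 * PI.
Proof.
  pose proof PI_RGT_0. destruct (base_Int_part (Rabs (s - t) / (2 * PI))) as [H1 H2].
  set (k := IZR (Int_part _)) in *. set (r := Rabs (s - t)) in *.
  assert (E : r = 2 * PI * (r / (2 * PI))) by (field; lra).
  set (p := r / (2 * PI)) in *. rewrite E, <- Rmult_minus_distr_l.
  split; [apply Rmult_le_pos; lra|].
  rewrite <- (Rmult_1_r (2 * PI)) at 2. apply Rmult_lt_compat_l; lra.
Qed.

Lemma cos_angdist (s t : R) : cos (angdist s t) = cos (s - t).
Proof.
  pose proof PI_RGT_0.
  assert (Hx : cos (Rabs (s - t) - 2 * PI * IZR (Int_part (Rabs (s - t) / (2 * PI))))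
    = cos (s - t)).
  { assert (Hk : (0 <= Int_part (Rabs (s - t) / (2 * PI)))%Z).
    { destruct (base_Int_part (Rabs (s - t) / (2 * PI))) as [_ H2].
      assert (0 <= Rabs (s - t) / (2 * PI))
        by (apply Rle_div_r; [lra|rewrite Rmult_0_l; apply Rabs_pos]).
      apply le_IZR. assert (H3 : -1 < IZR (Int_part (Rabs (s - t) / (2 * PI)))) by lra.
      apply lt_IZR in H3. apply IZR_le. lia. }
    set (k := Int_part _) in *.
    rewrite <- (Z2Nat.id k), <- INR_IZR_INZ by easy.
    rewrite <- (cos_period _ (Z.to_nat k)).
    replace (_ - _ + _) with (Rabs (s - t)) by ring.
    unfold Rabs; destruct (Rcase_abs _); [apply cos_neg|reflexivity]. }
  unfold angdist, Rmin. destruct (Rle_dec _ _); [exact Hx|].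
  rewrite <- Hx, <- (cos_neg (_ - _ * _)).
  replace (2 * PI - _) with
    (- (Rabs (s - t) - 2 * PI * IZR (Int_part (Rabs (s - t) / (2 * PI)))) + 2 * INR 1 * PI)
    by (simpl; ring).
  apply cos_period.
Qed.

Lemma angdist_ge_0 (s t : R) : 0 <= angdist s t.
Proof.
  pose proof (angdist_bounds s t). unfold angdist. apply Rmin_glb; lra.
Qed.

(** With [u] the angular distance, the squared chord is
    [2 - 2 cos u = 4 sin (u / 2) ^ 2 <= u ^ 2]. *)
Lemma chord_le_angdist (s t : R) : Cmod (Cminus (cis s) (cis t)) <= angdist s t.
Proof.
  pose proof (angdist_ge_0 s t) as Hu.
  apply Rsqr_incr_0_var; [|easy]. unfold Rsqr.
  apply Rle_trans with (2 - 2 * cos (angdist s t)).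
  - rewrite cos_angdist, cos_minus.
    replace (_ * _) with (Cmod (Cminus (cis s) (cis t)) ^ 2) by ring.
    rewrite Cmod2_alt; unfold cis; simpl.
    pose proof (sin2_cos2 s); pose proof (sin2_cos2 t); unfold Rsqr in *. lra.
  - set (u := angdist s t) in *. set (y := u / 2).
    replace u with (2 * y) by (unfold y; field). rewrite cos_2a_sin.
    assert (Hy : 0 <= y) by (unfold y; lra).
    assert (- y <= sin y <= y).
    { pose proof (SIN_bound y). pose proof PI_RGT_0. pose proof PI2_3_2.
      split; [|destruct Hy as [Hy| <-]; [left; now apply sin_lt_x|rewrite sin_0; lra]].
      destruct (Rle_dec y 1); [|lra].
      pose proof (sin_ge_0 y). lra. }
    nra.
Qed.

Lemma angdist_eq_0 (s t : R) : Rabs (s - t) < 2 * PI -> angdist s t <= 0 -> s = t.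
Proof.
  intros Hst Hd. pose proof PI_RGT_0.
  assert (Hk : Int_part (Rabs (s - t) / (2 * PI)) = 0%Z).
  { destruct (base_Int_part (Rabs (s - t) / (2 * PI))) as [H1 H2].
    assert (0 <= Rabs (s - t) / (2 * PI))
      by (apply Rle_div_r; [lra|rewrite Rmult_0_l; apply Rabs_pos]).
    assert (Rabs (s - t) / (2 * PI) < 1) by (apply Rlt_div_l; lra).
    set (k := Int_part _) in *.
    assert (Ha : IZR (-1) < IZR k) by lra. assert (Hb : IZR k < IZR 1) by lra.
    apply lt_IZR in Ha; apply lt_IZR in Hb. lia. }
  unfold angdist in Hd; rewrite Hk in Hd.
  assert (H0 : Rabs (s - t) <= 0).
  { revert Hd; unfold Rmin; destruct (Rle_dec _ _); lra. }
  pose proof (Rle_abs (s - t)). pose proof (Rle_abs (- (s - t))) as H2.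
  rewrite Rabs_Ropp in H2. lra.
Qed.

Lemma dist_set_attained (s : R) (pts : list R) :
  pts <> nil -> exists t, In t pts /\ dist_set s pts = angdist s t.
Proof.
  induction pts as [|t pts IH]; [easy|intros _].
  destruct pts as [|t' pts]; [exists t; simpl; auto|].
  destruct IH as (u & Hu & E); [easy|].
  change (dist_set s (t :: t' :: pts)) with (Rmin (angdist s t) (dist_set s (t' :: pts))).
  unfold Rmin; destruct (Rle_dec _ _).
  - exists t; split; [now left|reflexivity].
  - exists u; split; [now right|exact E].
Qed.

Lemma list_not_cover (l : list R) (a b : R) : a < b -> exists s, a <= s <= b /\ ~ In s l.
Proof.
  revert a b; induction l as [|x l IH]; intros a b Hab.
  - exists a; split; [lra|easy].
  - destruct (Rle_dec x ((a + b) / 2)).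
    + destruct (IH ((a + 3 * b) / 4) b) as (s & Hs & Hn); [lra|].
      exists s; split; [lra|]. intros [E|Hi]; [lra|easy].
    + destruct (IH a ((a + b) / 2)) as (s & Hs & Hn); [lra|].
      exists s; split; [lra|]. intros [E|Hi]; [lra|easy].
Qed.

(** Finitely many nodes cannot exhaust the arc, and a missed point is at positive distance: as
    [lam < 1], distinct parameters in the arc are distinct on the circle. This makes [ln (1 / h)]
    meaningful. *)
Lemma fill_distance_pos (t0 lam h : R) (pts : list R) :
  0 < lam < 1 -> pts <> nil -> (forall t, In t pts -> in_arc t0 lam t) ->
  (forall s, in_arc t0 lam s -> dist_set s pts <= h) -> 0 < h.
Proof.
  intros Hl Hne Hin Hh. pose proof PI_RGT_0.
  destruct (Rlt_dec 0 h) as [|Hn]; [easy|exfalso].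
  destruct (list_not_cover pts t0 (t0 + 2 * PI * lam)) as (s & Hs & Hns); [nra|].
  destruct (dist_set_attained s pts Hne) as (t & Ht & E).
  specialize (Hh s Hs). specialize (Hin t Ht). unfold in_arc in Hin.
  apply Hns. replace s with t; [easy|]. symmetry; apply angdist_eq_0; [|lra].
  apply Rle_lt_trans with (2 * PI * lam); [apply Rabs_le; lra|nra].
Qed.

(** * Sobolev weights and differences of functions *)

Lemma sum_f_R0_ge_term (f : nat -> R) (k j : nat) :
  (forall i, 0 <= f i) -> (j <= k)%nat -> f j <= sum_f_R0 f k.
Proof.
  intros Hf; induction 1 as [|k _ IH].
  - destruct j as [|j]; simpl; [lra|]. pose proof (cond_pos_sum f j Hf); lra.
  - simpl. specialize (Hf (S k)); lra.
Qed.

Lemma sob_weight_ge (k n j : nat) : (j <= k)%nat -> ffact n j ^ 2 <= sob_weight k n.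
Proof.
  apply (sum_f_R0_ge_term (fun j => ffact n j ^ 2)). intros; apply pow2_ge_0.
Qed.

Lemma sob_weight_ge_0 (k n : nat) : 0 <= sob_weight k n.
Proof. eapply Rle_trans; [apply pow2_ge_0|apply (sob_weight_ge k n 0); lia]. Qed.

Lemma sob_weight_ge_1 (k n : nat) : 1 <= sob_weight k n.
Proof. eapply Rle_trans; [|apply (sob_weight_ge k n 0); lia]. simpl; lra. Qed.

Lemma sob_weight_ge_sq (k n : nat) : (1 <= k)%nat -> INR n ^ 2 <= sob_weight k n.
Proof.
  intros Hk; eapply Rle_trans; [|apply (sob_weight_ge k n 1); lia].
  simpl. apply Req_le; ring.
Qed.

(** For [n >= 2 k] each of the [k] factors [n - j] of the falling factorial is at least [n / 2]. *)
Lemma sob_weight_ge_pow (k n : nat) :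
  2 * INR k <= INR n -> (INR n / 2) ^ (2 * k) <= sob_weight k n.
Proof.
  intros Hn; eapply Rle_trans; [|apply (sob_weight_ge k n k); lia].
  rewrite Nat.mul_comm, pow_mult. apply pow_incr.
  assert (Hf : forall j, (j <= k)%nat -> 0 <= (INR n / 2) ^ j <= ffact n j).
  { pose proof (pos_INR n). induction j as [|j IH]; intros Hj; [simpl; lra|].
    specialize (IH ltac:(lia)). apply (le_INR (S j)) in Hj; rewrite S_INR in Hj.
    split; [apply pow_le; lra|]. simpl. rewrite Rmult_comm.
    apply Rmult_le_compat; lra. }
  now apply Hf.
Qed.

Lemma rsum_sum_n (f : nat -> R) (N : nat) : rsum f (S N) = sum_n f N.
Proof.
  induction N as [|N IH]; [rewrite sum_O; simpl; ring|].
  rewrite sum_Sn, <- IH; reflexivity.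
Qed.

Lemma rsum_le_Series (f : nat -> R) (N : nat) :
  (forall n, 0 <= f n) -> ex_series f -> rsum f (S N) <= Series f.
Proof.
  intros Hf Hex. rewrite rsum_sum_n.
  apply (is_lim_seq_incr_compare (sum_n f)).
  - apply (Series_correct f Hex).
  - intros n; rewrite sum_Sn. unfold plus; simpl. specialize (Hf (S n)); lra.
Qed.

Lemma sob_terms_ge_0 (k : nat) (a : nat -> C) (n : nat) : 0 <= sob_terms k a n.
Proof. apply Rmult_le_pos; [apply sob_weight_ge_0|apply pow2_ge_0]. Qed.

Lemma sob_terms_sub_le (k : nat) (f g : nat -> C) (n : nat) :
  sob_terms k (Csub f g) n <= 2 * sob_terms k f n + 2 * sob_terms k g n.
Proof.
  unfold sob_terms, Csub. pose proof (sob_weight_ge_0 k n).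
  assert (Cmod (Cminus (f n) (g n)) ^ 2 <= 2 * Cmod (f n) ^ 2 + 2 * Cmod (g n) ^ 2).
  { rewrite !Cmod2_alt; destruct (f n) as [x y], (g n) as [u v]; simpl.
    pose proof (pow2_ge_0 (x + u)); pose proof (pow2_ge_0 (y + v)). lra. }
  nra.
Qed.

(** Termwise [|x - y|^2 <= 2 |x|^2 + 2 |y|^2] gives summability and bound together. *)
Lemma sob_sub (k : nat) (f g : nat -> C) : in_Hk2 k f -> in_Hk2 k g ->
  in_Hk2 k (Csub f g) /\
  normk2_sq k (Csub f g) <= 2 * normk2_sq k f + 2 * normk2_sq k g.
Proof.
  unfold in_Hk2, normk2_sq; intros Hf Hg.
  assert (Hex : ex_series (fun n => 2 * sob_terms k f n + 2 * sob_terms k g n)).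
  { apply (ex_series_plus (fun n => 2 * sob_terms k f n) (fun n => 2 * sob_terms k g n));
      now apply (ex_series_scal (V := R_NormedModule) 2). }
  assert (Hle : forall n, 0 <= sob_terms k (Csub f g) n <=
    2 * sob_terms k f n + 2 * sob_terms k g n).
  { intros; split; [apply sob_terms_ge_0|apply sob_terms_sub_le]. }
  split.
  - apply (ex_series_le (V := R_CompleteNormedModule) _ _) with (2 := Hex).
    intros n. unfold norm; simpl. unfold abs; simpl. rewrite Rabs_pos_eq; apply Hle.
  - eapply Rle_trans; [apply (Series_le _ _ Hle Hex)|].
    rewrite Series_plus, !Series_scal_l; [apply Rle_refl| |];
      now apply (ex_series_scal (V := R_NormedModule) 2).
Qed.

Lemma same_value_sub (f g : nat -> C) (t : R) :
  same_value_at g f t -> bval (Csub f g) t (RtoC 0).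
Proof.
  intros (v & Hg & Hf). unfold bval in *.
  pose proof (is_series_minus _ _ _ _ Hf Hg) as H.
  refine (eq_ind _ (fun x => is_series _ x) _ _ (plus_opp_r (G := C_NormedModule) v)).
  eapply is_series_ext; [|exact H]. intros n. unfold Csub.
  change (Cplus (Cmult (f n) (cexp_int n t)) (Copp (Cmult (g n) (cexp_int n t)))
    = Cmult (Cminus (f n) (g n)) (cexp_int n t)). ring.
Qed.

(** * Decay of the coefficients and final summation *)

Lemma exists_reciprocal (lam : R) : 0 < lam < 1 ->
  exists q : nat, (1 <= q)%nat /\ / INR q <= lam /\ INR q <= 2 / lam.
Proof.
  intros Hl.
  assert (H1 : 1 < / lam) by (rewrite <- Rinv_1; apply Rinv_lt_contravar; lra).
  (* Plateaus are built for arcs of length [2 PI / q]; rounding [1 / lam] up shrinks the arc by at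
     most a factor 2. *)
  destruct (nfloor_ex (/ lam)) as [n [Hn1 Hn2]]; [lra|].
  exists (S n); rewrite S_INR. split; [lia|split].
  - rewrite <- (Rinv_inv lam). apply Rinv_le_contravar; lra.
  - unfold Rdiv; lra.
Qed.

Lemma coef_decay (k : nat) (g : nat -> C) (lam t0 h : R) (pts : list R) (n : nat) :
  (1 <= k)%nat -> 0 < lam < 1 -> in_Hk2 k g -> normk2_sq k g <= 4 ->
  pts <> nil -> (forall t, In t pts -> bval g t (RtoC 0)) ->
  0 < h <= 1 -> (forall s, in_arc t0 lam s -> dist_set s pts <= h) ->
  Cmod (g n) <= 36 * 4 ^ n * exp (- (lam * ln (1 / h) / 144)).
Proof.
  intros Hk Hl Hg Hg4 Hne Hb Hh Hd. pose proof PI_RGT_0 as Hpi.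
  destruct (exists_reciprocal lam Hl) as (q & Hq1 & Hq2 & Hq3).
  assert (Hs : 0 < sqrt h) by (apply sqrt_lt_R0; lra).
  (* With this tolerance the partial sum on the arc is at most [(13/2 + 1/2) * sqrt h], within the
     [9 * sqrt h] wanted. *)
  destruct (peval_series_zero_list g pts (sqrt h / 2) Hb ltac:(lra)) as [N0 HN0].
  set (N := (N0 + n)%nat). specialize (HN0 N ltac:(lia)).
  assert (Hq0 : 0 < INR q) by (apply lt_0_INR; lia).
  assert (HE : rsum (fun i => INR i ^ 2 * Cmod (g i) ^ 2) (S N) <= 4).
  { eapply Rle_trans; [|exact Hg4].
    eapply Rle_trans; [|apply (rsum_le_Series _ N (sob_terms_ge_0 k g) Hg)].
    apply rsum_le; intros i _. apply Rmult_le_compat_r; [apply pow2_ge_0|].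
    now apply sob_weight_ge_sq. }
  assert (H0 : Cmod (g O) <= 2).
  { pose proof (rsum_le_Series _ 0 (sob_terms_ge_0 k g) Hg) as H.
    fold (normk2_sq k g) in H. simpl rsum in H. unfold sob_terms at 1 in H.
    pose proof (sob_weight_ge_1 k 0). pose proof (Cmod_ge_0 (g O)).
    pose proof (pow2_ge_0 (Cmod (g O))). nra. }
  set (L := ln (1 / h)).
  assert (HL : 0 <= L).
  { unfold L. replace (1 / h) with (/ h) by (unfold Rdiv; ring).
    rewrite ln_Rinv by lra. destruct Hh as [Hh0 [Hh1| ->]].
    - pose proof (ln_increasing h 1 Hh0 Hh1). rewrite ln_1 in *. lra.
    - rewrite ln_1; lra. }
  assert (Hsq : exp (- (L / 2)) = sqrt h).
  { apply Rsqr_inj; [left; apply exp_pos|lra|].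
    rewrite Rsqr_sqrt by lra. unfold Rsqr; rewrite <- exp_plus.
    unfold L. replace (1 / h) with (/ h) by (unfold Rdiv; ring).
    rewrite ln_Rinv by lra. transitivity (exp (ln h)); [f_equal; field|apply exp_ln; lra]. }
  (* Rotation moves the start of the arc to angle 0 and keeps the moduli of the coefficients. *)
  set (b := fun m => Cmult (g m) (Cpow (cis t0) m)).
  assert (Hbg : forall t, peval b (S N) (cis t) = peval g (S N) (cis (t0 + t))).
  { intros t. unfold peval; apply csum_ext; intros m _. unfold b.
    rewrite cis_plus, Cpow_mult_l; ring. }
  pose proof (two_constants b (S N) q n 9 (L / 2) Hq1 ltac:(lra) ltac:(lra)) as H.
  assert (Hbn : Cmod (b n) = Cmod (g n)).
  { unfold b; rewrite Cmod_mult, Cmod_pow, Cmod_cis, pow1; ring. }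
  rewrite Hbn in H.
  eapply Rle_trans; [apply H|].
  - intros t _. rewrite Hbg. now apply peval_cis_bound.
  - intros t Ht. rewrite Hbg, Hsq.
    assert (Hin : in_arc t0 lam (t0 + t)).
    { unfold in_arc. unfold Rdiv in Ht. nra. }
    specialize (Hd _ Hin).
    destruct (dist_set_attained (t0 + t) pts Hne) as (s & Hsp & E).
    specialize (HN0 s Hsp).
    pose proof (chord_le_angdist (t0 + t) s) as Hc.
    pose proof (peval_cis_diff g N (t0 + t) s h ltac:(lra) ltac:(lra) HE) as H1.
    set (u := peval g (S N) (cis (t0 + t))) in *. set (v := peval g (S N) (cis s)) in *.
    replace u with (Cplus (Cminus u v) v) by ring.
    eapply Rle_trans; [apply Cmod_triangle|]. lra.
  - unfold N; lia.
  - replace (36 * 4 ^ n * exp (- (lam * L / 144)))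
      with (4 ^ n * (4 * 9 * exp (- (lam * L / 144)))) by ring.
    apply Rmult_le_compat_l; [apply pow_le; lra|]. apply Rmult_le_compat_l; [lra|].
    apply exp_le, Ropp_le_contravar.
    assert (Hlq : lam * INR q <= 2) by (rewrite Rmult_comm; apply Rle_div_r; lra).
    apply Rmult_le_reg_r with (144 * INR q); [lra|].
    replace (lam * L / 144 * (144 * INR q)) with (L * (lam * INR q)) by field.
    replace (L / 2 / (36 * INR q) * (144 * INR q)) with (L * 2) by (field; lra).
    now apply Rmult_le_compat_l.
Qed.

(** The [n]-th power of [exp (- y) <= 1 / y] at [y = x / n]; it trades exponential decay for a
    power. *)
Lemma exp_neg_le_pow (x : R) (n : nat) : 0 < x -> (0 < n)%nat -> exp (- x) <= (INR n / x) ^ n.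
Proof.
  intros Hx Hn. assert (HN : 0 < INR n) by now apply lt_0_INR.
  assert (Hp : 0 < x / INR n) by now apply Rdiv_lt_0_compat.
  replace (- x) with (INR n * - (x / INR n)) by (field; lra).
  rewrite exp_INR_mult. apply pow_incr; split; [left; apply exp_pos|].
  rewrite exp_Ropp. replace (INR n / x) with (/ (x / INR n)) by (field; lra).
  apply Rinv_le_contravar; [easy|]. pose proof (exp_ineq1_le (x / INR n)); lra.
Qed.

(** [32 = 4 ^ 2 * 2]: the square of [4 ^ n] is absorbed with a spare [2 ^ n] for summability. *)
Lemma exp_4_ge_32 : 32 <= exp 4.
Proof.
  replace 4 with (INR 8 * (1 / 2)) by (simpl; field). rewrite exp_INR_mult.
  assert (H : 16 / 10 <= exp (1 / 2)).
  { replace (1 / 2) with (INR 4 * (1 / 8)) by (simpl; field). rewrite exp_INR_mult.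
    apply Rle_trans with ((1 + 1 / 8) ^ 4); [lra|].
    apply pow_incr; split; [lra|apply exp_ineq1_le]. }
  apply Rle_trans with ((16 / 10) ^ 8); [lra|]. apply pow_incr; lra.
Qed.

(** For [n <= Y / 576], [32 ^ n <= exp (4 n) <= exp (Y / 144)] uses up one of the two exponential
    factors in the square. For larger [n], which exceed [2 k], the weight is at least
    [(Y / 1152) ^ (2 k)]. *)
Lemma coef_sq_le (k : nat) (g : nat -> C) (Y : R) (n : nat) :
  0 < Y -> 1152 * INR k <= Y ->
  Cmod (g n) <= 36 * 4 ^ n * exp (- (Y / 144)) ->
  Cmod (g n) ^ 2 <= 1296 * exp (- (Y / 144)) * (1 / 2) ^ n
                    + (1152 / Y) ^ (2 * k) * sob_terms k g n.
Proof.
  intros HY HkY Hn.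
  pose proof (exp_pos (- (Y / 144))) as He.
  assert (Hr : 0 <= (1152 / Y) ^ (2 * k) * sob_terms k g n).
  { apply Rmult_le_pos; [apply pow_le, Rle_div_r; lra|apply sob_terms_ge_0]. }
  assert (Hl : 0 <= 1296 * exp (- (Y / 144)) * (1 / 2) ^ n).
  { apply Rmult_le_pos; [lra|apply pow_le; lra]. }
  destruct (Rle_dec (INR n) (Y / 576)) as [Hsmall|Hlarge].
  - assert (H32 : 32 ^ n <= exp (Y / 144)).
    { apply Rle_trans with (exp 4 ^ n); [apply pow_incr; pose proof exp_4_ge_32; lra|].
      rewrite <- exp_INR_mult. apply exp_le; lra. }
    apply Rle_trans with ((36 * 4 ^ n * exp (- (Y / 144))) ^ 2).
    { apply pow_incr; split; [apply Cmod_ge_0|easy]. }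
    replace ((36 * 4 ^ n * exp (- (Y / 144))) ^ 2)
      with (1296 * exp (- (Y / 144)) * ((1 / 2) ^ n * (32 ^ n * exp (- (Y / 144))))).
    2:{ replace ((1 / 2) ^ n * (32 ^ n * exp (- (Y / 144))))
          with (((1 / 2) * 32) ^ n * exp (- (Y / 144))) by (rewrite Rpow_mult_distr; ring).
        replace (1 / 2 * 32) with (4 * 4) by field. rewrite Rpow_mult_distr; ring. }
    assert (32 ^ n * exp (- (Y / 144)) <= 1).
    { rewrite exp_Ropp. apply Rle_div_l; [apply exp_pos|lra]. }
    assert (0 < (1 / 2) ^ n) by (apply pow_lt; lra).
    apply Rle_trans with (1296 * exp (- (Y / 144)) * ((1 / 2) ^ n * 1)); [|lra].
    apply Rmult_le_compat_l; [lra|]. apply Rmult_le_compat_l; lra.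
  - assert (Hw : (INR n / 2) ^ (2 * k) <= sob_weight k n).
    { apply sob_weight_ge_pow; lra. }
    assert (H1 : 1 <= (1152 / Y) ^ (2 * k) * (INR n / 2) ^ (2 * k)).
    { rewrite <- Rpow_mult_distr. apply pow_R1_Rle.
      replace (1152 / Y * (INR n / 2)) with (576 * INR n / Y) by (field; lra).
      apply Rle_div_r; lra. }
    assert (Hc : 0 < (1152 / Y) ^ (2 * k)) by (apply pow_lt, Rdiv_lt_0_compat; lra).
    unfold sob_terms. rewrite <- Rmult_assoc.
    assert (1 <= (1152 / Y) ^ (2 * k) * sob_weight k n).
    { eapply Rle_trans; [exact H1|]. apply Rmult_le_compat_l; lra. }
    pose proof (pow2_ge_0 (Cmod (g n))). nra.
Qed.

(** The geometric series gives [2 * 1296], the exponential at [x = Y / 144] with power [2 k] gives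
    [288 k / Y], and the Sobolev norm gives the 4. *)
Lemma norm2_le_of_coef_decay (k : nat) (g : nat -> C) (Y : R) :
  (1 <= k)%nat -> 1152 * INR k <= Y -> in_Hk2 k g -> normk2_sq k g <= 4 ->
  (forall n, Cmod (g n) <= 36 * 4 ^ n * exp (- (Y / 144))) ->
  norm2 g <= sqrt (2592 * (288 * INR k) ^ (2 * k) + 4 * 1152 ^ (2 * k)) / Y ^ k.
Proof.
  intros Hk HkY Hg Hg4 Hc.
  assert (HkR : 1 <= INR k) by (apply (le_INR 1); lia).
  assert (HY : 0 < Y) by lra.
  set (c1 := 1296 * exp (- (Y / 144))). set (c2 := (1152 / Y) ^ (2 * k)).
  assert (Hhalf : Rabs (1 / 2) < 1) by (rewrite Rabs_pos_eq; lra).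
  assert (E1 : ex_series (fun n => c1 * (1 / 2) ^ n)).
  { apply (ex_series_scal (V := R_NormedModule) c1). now apply ex_series_geom. }
  assert (E2 : ex_series (fun n => c2 * sob_terms k g n)).
  { now apply (ex_series_scal (V := R_NormedModule) c2). }
  assert (Hc2 : 0 <= c2) by (apply pow_le, Rle_div_r; lra).
  assert (HS : Series (fun n => Cmod (g n) ^ 2) <= 2 * c1 + c2 * 4).
  { eapply Rle_trans; [apply (Series_le _ (fun n => c1 * (1 / 2) ^ n + c2 * sob_terms k g n))|].
    - intros n; split; [apply pow2_ge_0|now apply coef_sq_le].
    - now apply (ex_series_plus (V := R_NormedModule)).
    - rewrite Series_plus, !Series_scal_l, Series_geom by easy.
      apply Rplus_le_compat; [lra|]. now apply Rmult_le_compat_l. }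
  assert (HYk : 0 < Y ^ (2 * k)) by now apply pow_lt.
  assert (HB : 2 * c1 + c2 * 4 <=
    (2592 * (288 * INR k) ^ (2 * k) + 4 * 1152 ^ (2 * k)) / Y ^ (2 * k)).
  { assert (Hexp : exp (- (Y / 144)) <= (288 * INR k) ^ (2 * k) / Y ^ (2 * k)).
    { eapply Rle_trans; [apply (exp_neg_le_pow (Y / 144) (2 * k)); [lra|lia]|].
      apply Req_le. rewrite mult_INR. unfold Rdiv at 3. rewrite <- pow_inv, <- Rpow_mult_distr.
      f_equal. simpl INR; field; lra. }
    unfold c2, c1. unfold Rdiv at 2. rewrite Rpow_mult_distr, pow_inv. unfold Rdiv in *. lra. }
  unfold norm2. replace (Y ^ k) with (sqrt (Y ^ (2 * k))).
  2:{ rewrite Nat.mul_comm, pow_mult. apply sqrt_pow2. apply pow_le; lra. }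
  rewrite <- sqrt_div_alt by easy.
  apply sqrt_le_1_alt. lra.
Qed.

Theorem theorem4 :
  forall k : nat, (1 <= k)%nat ->
  exists alpha gamma : R, 0 < alpha /\ 0 < gamma /\
  forall (lam t0 : R) (f : nat -> C) (pts : list R) (fn : nat -> C) (h : R),
    0 < lam < 1 ->
    in_Hk2 k f -> normk2_sq k f <= 1 ->
    pts <> nil -> NoDup pts -> (forall t, In t pts -> in_arc t0 lam t) ->
    (* fn is the minimal-norm interpolant *)
    in_Hk2 k fn ->
    (forall t, In t pts -> same_value_at fn f t) ->
    (forall g : nat -> C, in_Hk2 k g -> (forall t, In t pts -> same_value_at g f t) ->
        normk2_sq k fn <= normk2_sq k g) ->
    (* h = h_n = sup_{x in I} d(x, S_n) *)
    is_lub (fun r => exists s, in_arc t0 lam s /\ r = dist_set s pts) h ->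
    h <= exp (- gamma / lam) ->
    norm2 (Csub f fn) <= alpha / (lam * ln (1 / h)) ^ k.
Proof.
  intros k Hk.
  assert (HkR : 1 <= INR k) by (apply (le_INR 1); lia).
  exists (sqrt (2592 * (288 * INR k) ^ (2 * k) + 4 * 1152 ^ (2 * k))), (1152 * INR k).
  split; [|split; [lra|]].
  { apply sqrt_lt_R0. apply Rplus_lt_0_compat; apply Rmult_lt_0_compat; try lra;
      apply pow_lt; lra. }
  intros lam t0 f pts fn h Hl Hf Hf1 Hne _ Hin Hfn Hval Hmin [Hub _] Hh.
  assert (Hd : forall s, in_arc t0 lam s -> dist_set s pts <= h).
  { intros s Hs; apply Hub; now exists s. }
  pose proof (fill_distance_pos t0 lam h pts Hl Hne Hin Hd) as Hh0.
  (* Minimality is applied with [f] itself as competitor. *)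
  assert (Hfn1 : normk2_sq k fn <= 1).
  { eapply Rle_trans; [apply (Hmin f Hf)|easy].
    intros t Ht; destruct (Hval t Ht) as (v & _ & Hv); now exists v. }
  destruct (sob_sub k f fn Hf Hfn) as [Hg Hg4].
  assert (Hln : 1152 * INR k / lam <= ln (1 / h)).
  { replace (1 / h) with (/ h) by (unfold Rdiv; ring). rewrite ln_Rinv by easy.
    apply Ropp_le_cancel. rewrite Ropp_involutive.
    rewrite <- (ln_exp (- (1152 * INR k / lam))).
    apply ln_le; [easy|]. now rewrite <- Rdiv_opp_l. }
  assert (Hle1 : h <= 1).
  { eapply Rle_trans; [exact Hh|]. rewrite <- exp_0. apply exp_le.
    apply Rle_div_l; lra. }
  apply norm2_le_of_coef_decay; [easy| |easy|lra|].
  - rewrite (Rmult_comm lam). apply (Rle_div_l _ (ln (1 / h))); lra.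
  - intros n. apply (coef_decay k _ lam t0 h pts n); try easy; try lra.
    intros t Ht. apply same_value_sub, Hval, Ht.
Qed.
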